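(* Let a directed acyclic graph $G$ on the variables $X_1,\dots,X_n$, an imprecise dataset $\mathcal{D}$ with counts $N_{ijk}$, a fixed parameter $\pi_{ijk}$ and an imprecision degree $S_i$ (a prefixed value) relative to the variable $X_i$ be given. The maximum possibilistic likelihood estimates are the parameter values, i.e. the values of the possibility degrees $\pi_{ijk}\in[0,1]$, that maximize the possibilistic log-likelihood $$\pi LL(\pi,G,\mathcal{D})=\sum_{i=1}^n\sum_{j=1}^{q_i}\sum_{k=1}^{r_i}N_{ijk}\log\pi_{ijk}.$$ Assume that $\sum_{k=1}^{r_i}\pi_{ijk}$ is a constant equal to $S_i$. Then $\pi LL(\pi,G,\mathcal{D})$ reaches its maximum in $$\hat\pi_{ijk}=\operatorname{argmax}\bigl(\pi LL(\pi,G,\mathcal{D})\bigr)=\frac{N_{ijk}}{\sum_{k=1}^{r_i}N_{ijk}}\cdot S_i .$$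
   Context: Each variable $X_i$ has a finite domain $D_i=\{x_{i1},\dots,x_{ir_i}\}$ with $r_i=|D_i|$, and $Pa(X_i)$ denotes the parents of $X_i$ in $G$. The index $j=1,\dots,q_i$ runs over the joint values of $Pa(X_i)$, $q_i$ being their number. A possibility distribution is a mapping from a domain to the unit interval $[0,1]$; it is called normalized if at least one state has degree $1$. The parameters $\{\pi_1,\dots,\pi_n\}$ to be estimated are the (conditional) possibility distributions of $X_1,\dots,X_n$: $\pi_{ijk}$ is the possibility degree to be estimated when $X_i=x_{ik}$ and $Pa(X_i)=j$. In the paper, normalized distributions are obtained after estimation, by dividing every obtained distribution by its maximum. The dataset is imprecise: for each $X_i$ and its parents with $Pa(X_i)=j$ it provides observations $\mathcal{D}_{ij}=\{d_{ij}^{(l)}\}$, each $d_{ij}^{(l)}$ being a set of values considered possible. The count $N_{ijk}$ is the number of observations $l$ such that the combination of $X_i=x_{ik}$ with $Pa(X_i)=j$ is contained in $d_{ij}^{(l)}$; one observation may contribute to several counts. If the obtained possibility distributions are equal to zero, the paper adds an initial count of $1$ to all $N_{ijk}$ (and to the total accordingly). The imprecision degree $S_i$ relative to $X_i$ may be fixed by an expert, inferred from the dataset, or based on the description of the variables.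
   Formalization: The formula can exceed 1 (N=(9,1), S=1.5 gives 1.35), so for degrees in [0,1] the claim is proved when the formula's values lie in [0,1]; for nonnegative degrees with sums S_i it is proved without that condition; S_i is assumed positive. *)

(* Defs.v *)
From HB Require Import structures.
From mathcomp Require Import all_boot all_order all_algebra.
From mathcomp Require Import all_classical all_reals all_analysis.

Set Implicit Arguments.
Unset Strict Implicit.
Unset Printing Implicit Defensive.

Import Order.TTheory GRing.Theory Num.Theory.

Local Open Scope classical_set_scope.
Local Open Scope ring_scope.

(* [G u v]: there is an edge from u to v, i.e. u is a parent of v. [path.cycle G]
   holds of the closed walks of G (self-loops included) and of [::]. *)
Definition acyclic (n : nat) (G : rel 'I_n) : Prop :=
  forall c : seq 'I_n, path.cycle G c -> c = [::].

Definition argmax (R : realType) (T : Type) (A : set T) (f : T -> \bar R) :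
    set T :=
  [set x | A x /\ forall y, A y -> (f y <= f x)%E].

Section PossibilisticNetwork.
Variables (R : realType) (n : nat) (G : rel 'I_n) (D : 'I_n -> finType).

(* The joint values j of Pa(X_i); the number q_i is the cardinal of this type
   (one empty configuration when X_i is a root). *)
Definition paval (i : 'I_n) : finType :=
  {dffun forall p : {p : 'I_n | G p i}, D (val p)}.

(* The observations d_ij^(l), listed with repetitions; each one is the set of
   the combinations of X_i and Pa(X_i) that it considers possible. *)
Definition dataset : Type :=
  forall i : 'I_n, paval i -> seq {set D i * paval i}.

Definition raw_count (Dt : dataset) (i : 'I_n) (j : paval i) (k : D i) : nat :=
  count (fun d : {set D i * paval i} => (k, j) \in d) (Dt i j).

(* When no observation supports any value of X_i, the estimate would be
   identically zero; an initial count of 1 is then given to every value. *)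
Definition Ncount (Dt : dataset) (i : 'I_n) (j : paval i) (k : D i) : nat :=
  (raw_count Dt j k + ((\sum_(k' : D i) raw_count Dt j k')%N == 0))%N.

(* An arbitrary real-valued family pi_ijk; the ranges are imposed separately. *)
Definition parameter : Type := forall i : 'I_n, paval i -> D i -> R.

Definition is_possibility (p : parameter) : Prop :=
  forall i (j : paval i) k, 0 <= p i j k <= 1.

Definition is_nonneg (p : parameter) : Prop :=
  forall i (j : paval i) k, 0 <= p i j k.

Definition has_imprecision (S : 'I_n -> R) (p : parameter) : Prop :=
  forall i (j : paval i), \sum_(k : D i) p i j k = S i.

(* [lne 0 = -oo], and [0 * -oo = 0] in [\bar R]: a degree 0 is ruled out
   exactly when its count is positive. *)
Definition piLL (Dt : dataset) (p : parameter) : \bar R :=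
  (\sum_(i < n) \sum_(j : paval i) \sum_(k : D i)
     (Ncount Dt j k)%:R%:E * lne (p i j k)%:E)%E.

Definition mple (Dt : dataset) (S : 'I_n -> R) : parameter :=
  fun i j k =>
    (Ncount Dt j k)%:R / (\sum_(k' : D i) Ncount Dt j k')%N%:R * S i.

End PossibilisticNetwork.

(* Main.v *)
Require Import Defs.
From HB Require Import structures.
From mathcomp Require Import all_boot all_order all_algebra.
From mathcomp Require Import all_classical all_reals all_analysis.
From mathcomp Require Import ring lra.

Import Order.TTheory GRing.Theory Num.Theory.

Local Open Scope classical_set_scope.
Local Open Scope ring_scope.

(* The log-likelihood is a sum over the pairs (i, j), each with its own
   constraint. Write m_k = N_k S / T, where T is the sum of the N_k. The tangent
   of the concave function N_k log at m_k gives
   N_k log p_k <= N_k log m_k + (T / S) (p_k - m_k), with equality only at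
   p_k = m_k; when N_k = 0 both logarithmic terms vanish, m_k = 0, and this still
   holds because p_k >= 0. The linear terms have total
   (T / S) (S - S) = 0 over k. *)

Section Tangent.
Set Implicit Arguments.
Unset Strict Implicit.
Variable R : realType.

(** This is [1 + x < expR x] for nonzero [x], taken at [x = ln (p / m)]. *)
Lemma ln_lt_tangent (m p : R) :
  0 < m -> 0 < p -> p != m -> ln p < ln m + (p - m) / m.
Proof.
move=> m0 p0 pm.
have pm0 : 0 < p / m by rewrite divr_gt0.
have L0 : ln (p / m) != 0.
  apply: contra pm => /eqP L0; apply/eqP/divr1_eq.
  by rewrite -[LHS]lnK ?posrE// L0 expR0.
have := expR_gt1Dx L0; rewrite lnK ?posrE// ln_div ?posrE//.
rewrite mulrBl divff ?gt_eqF//; lra.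
Qed.

Lemma mul_lne_lt_tangent (N : nat) (c m p : R) :
  0 < c -> N%:R = c * m -> 0 <= p -> p != m ->
  (N%:R%:E * lne p%:E < N%:R%:E * lne m%:E + (c * (p - m))%:E)%E.
Proof.
move=> c0 Nm p0 pm.
case: N Nm => [|N] Nm.
  (* With count 0 both products vanish, even against [-oo], and [0 < c * p] remains. *)
  have m0 : m = 0.
    by apply/eqP; move/esym/eqP: Nm; rewrite mulf_eq0 gt_eqF.
  by rewrite !mul0e add0e lte_fin mulr_gt0// m0 subr0 lt_neqAle eq_sym -m0 pm m0.
have m0 : 0 < m by rewrite -(pmulr_rgt0 _ c0) -Nm ltr0Sn.
rewrite (lne_EFin m0) -EFinM -EFinD.
(* At [p = 0] the positive count makes the left side [-oo], while the right side is real. *)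
move: p0; rewrite le_eqVlt => /predU1P[<-|p0].
  by rewrite /= lexx gt0_muleNy ?ltNyr// lte_fin ltr0Sn.
rewrite (lne_EFin p0) -EFinM lte_fin.
have -> : N.+1%:R * ln m + c * (p - m) = N.+1%:R * (ln m + (p - m) / m).
  by rewrite [RHS]mulrDr; congr (_ + _); rewrite {}Nm; field; rewrite gt_eqF.
by rewrite ltr_pM2l ?ltr0Sn// ln_lt_tangent.
Qed.

Lemma mul_lne_le_tangent (N : nat) (c m p : R) :
  0 < c -> N%:R = c * m -> 0 <= p ->
  (N%:R%:E * lne p%:E <= N%:R%:E * lne m%:E + (c * (p - m))%:E)%E.
Proof.
move=> c0 Nm p0; have [->|pm] := eqVneq p m.
  by rewrite subrr mulr0 adde0.
by rewrite ltW// mul_lne_lt_tangent.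
Qed.

(** A strict inequality at one index would make the whole sum strictly smaller. The bounds are real,
    but [f] may take the value [-oo]. *)
Lemma esum_ge_eq (I : finType) (f : I -> \bar R) (b : I -> R) :
  (forall k, f k <= (b k)%:E)%E -> ((\sum_k b k)%:E <= \sum_k f k)%E ->
  forall k, f k = (b k)%:E.
Proof.
move=> fb bf k; apply/eqP; rewrite eq_le fb leNgt; apply/negP => fk.
move: bf; rewrite leNgt => /negP; apply.
rewrite -sumEFin (bigD1 k)//= [ltRHS](bigD1 k)//=.
(* The other terms are first raised to their real bounds: a common summand cancels from a strict
   inequality in [\bar R] only if it is finite. *)
apply: (@le_lt_trans _ _ (f k + \sum_(i | i != k) (b i)%:E)%E).
  by apply: leeD2l; apply: lee_sum => i _.
by rewrite sumEFin lteD2rE.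
Qed.

End Tangent.

Section Maximum.
Set Implicit Arguments.
Unset Strict Implicit.
Variables (R : realType) (n : nat) (G : rel 'I_n) (D : 'I_n -> finType).
Variables (Dt : dataset G D) (S : 'I_n -> R).
Hypotheses (hD : forall i, (0 < #|D i|)%N) (hS : forall i, 0 < S i).

Let total (i : 'I_n) (j : paval G D i) : nat := (\sum_k Ncount Dt j k)%N.

(** If all raw counts vanish, the initial counts of 1 add up to [#|D i|], which is positive. *)
Lemma sum_Ncount_gt0 (i : 'I_n) (j : paval G D i) : (0 < total j)%N.
Proof.
rewrite /total /Ncount big_split/= sum_nat_const.
by case: eqP => [->|/eqP]; rewrite ?muln1 ?hD// muln0 addn0 lt0n.
Qed.

Lemma mple_ge0 : is_nonneg (mple Dt S).
Proof. by move=> i j k; rewrite /mple mulr_ge0 ?divr_ge0 ?ler0n// ltW. Qed.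

Lemma mple_imprecision : has_imprecision S (mple Dt S).
Proof.
move=> i j; rewrite /mple -mulr_suml -mulr_suml -natr_sum divff ?mul1r//.
by rewrite pnatr_eq0 -lt0n sum_Ncount_gt0.
Qed.

(** Where N_k > 0, this is the derivative N_k / m_k of N_k log at m_k. It is the same for all k: the
    Lagrange multiplier of the constraint on the sum. *)
Let slope (i : 'I_n) (j : paval G D i) : R := (total j)%:R / S i.

Lemma slope_gt0 (i : 'I_n) (j : paval G D i) : 0 < slope j.
Proof. by rewrite divr_gt0 ?ltr0n ?sum_Ncount_gt0. Qed.

Lemma Ncount_slope (i : 'I_n) (j : paval G D i) k :
  (Ncount Dt j k)%:R = slope j * mple Dt S j k.
Proof.
rewrite /slope /mple -/(total j); field.
by rewrite pnatr_eq0 -lt0n sum_Ncount_gt0 gt_eqF.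
Qed.

(** A real form of the terms at the estimate, which shows the maximum to be finite: a zero estimate
    has count 0, so the value of [ln] there does not matter. *)
Let mterm (i : 'I_n) (j : paval G D i) (k : D i) : R :=
  (Ncount Dt j k)%:R * ln (mple Dt S j k).

Lemma mterm_lne (i : 'I_n) (j : paval G D i) k :
  ((Ncount Dt j k)%:R%:E * lne (mple Dt S j k)%:E)%E = (mterm j k)%:E.
Proof.
rewrite /mterm; have := Ncount_slope j k.
case: (Ncount Dt j k) => [|N] Nm; first by rewrite mul0e mul0r.
by rewrite lne_EFin// -(pmulr_rgt0 _ (slope_gt0 j)) -Nm ltr0Sn.
Qed.

Lemma piLL_mple :
  piLL Dt (mple Dt S) = (\sum_i \sum_(j : paval G D i) \sum_k mterm j k)%:E.
Proof.
rewrite /piLL -sumEFin; apply: eq_bigr => i _.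
rewrite -sumEFin; apply: eq_bigr => j _.
by rewrite -sumEFin; apply: eq_bigr => k _; rewrite mterm_lne.
Qed.

Section Competitor.
Variable p : parameter R G D.
Hypotheses (p0 : is_nonneg p) (pS : has_imprecision S p).

Let bound (i : 'I_n) (j : paval G D i) (k : D i) : R :=
  mterm j k + slope j * (p j k - mple Dt S j k).

Lemma sum_bound (i : 'I_n) (j : paval G D i) :
  \sum_k bound j k = \sum_k mterm j k.
Proof.
rewrite big_split/= -mulr_sumr big_split/= sumrN.
by rewrite (pS j) (mple_imprecision j) subrr mulr0 addr0.
Qed.

Lemma term_le_bound (i : 'I_n) (j : paval G D i) k :
  ((Ncount Dt j k)%:R%:E * lne (p j k)%:E <= (bound j k)%:E)%E.
Proof.
by rewrite EFinD -mterm_lne mul_lne_le_tangent ?slope_gt0 ?Ncount_slope.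
Qed.

Lemma sum_term_le (i : 'I_n) (j : paval G D i) :
  (\sum_k (Ncount Dt j k)%:R%:E * lne (p j k)%:E <=
   (\sum_k mterm j k)%:E)%E.
Proof.
rewrite -sum_bound -sumEFin.
by apply: lee_sum => k _; exact: term_le_bound.
Qed.

Lemma sum2_term_le (i : 'I_n) :
  (\sum_(j : paval G D i) \sum_k (Ncount Dt j k)%:R%:E * lne (p j k)%:E <=
   (\sum_(j : paval G D i) \sum_k mterm j k)%:E)%E.
Proof. by rewrite -sumEFin; apply: lee_sum => j _; exact: sum_term_le. Qed.

Lemma piLL_le_mple : (piLL Dt p <= piLL Dt (mple Dt S))%E.
Proof.
by rewrite piLL_mple -sumEFin; apply: lee_sum => i _; exact: sum2_term_le.
Qed.

(** Equality of the totals descends through the three nested sums, first to each i, then to each j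
    and k. There the strict tangent inequality excludes any other value. *)
Lemma piLL_ge_mple_eq : (piLL Dt (mple Dt S) <= piLL Dt p)%E -> p = mple Dt S.
Proof.
rewrite piLL_mple => /(esum_ge_eq sum2_term_le) sum_i.
apply: functional_extensionality_dep => i.
apply/funext => j; apply/funext => k.
have := esum_ge_eq (@sum_term_le i) _ j.
rewrite sum_i lexx => /(_ isT) sum_j.
have := esum_ge_eq (@term_le_bound i j) _ k.
rewrite sum_j sum_bound lexx => /(_ isT) termE.
apply/eqP/negPn/negP => pm.
have := mul_lne_lt_tangent (slope_gt0 j) (Ncount_slope j k) (p0 j k) pm.
by rewrite termE mterm_lne -EFinD ltxx.
Qed.

End Competitor.

(** Leaving [A] abstract lets one argument serve both ranges, the degrees in [0,1] and the
    nonnegative ones. *)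
Lemma argmax_piLL (A : set (parameter R G D)) :
  A `<=` [set p | is_nonneg p /\ has_imprecision S p] -> A (mple Dt S) ->
  argmax A (piLL Dt) = [set mple Dt S].
Proof.
move=> AS Am; apply/seteqP; split => [p [Ap pmax]|_ ->].
  by have [p0 pS] := AS _ Ap; apply: piLL_ge_mple_eq => //; exact: pmax.
by split => // p /AS[p0 pS]; exact: piLL_le_mple.
Qed.

End Maximum.

Theorem proposition1 (R : realType) (n : nat) (G : rel 'I_n)
    (D : 'I_n -> finType) (Dt : dataset G D) (S : 'I_n -> R)
    (hG : acyclic G) (hD : forall i, (0 < #|D i|)%N)
    (hS : forall i, 0 < S i) :
  (is_possibility (mple Dt S) ->
     argmax [set p : parameter R G D | is_possibility p /\ has_imprecision S p]
       (piLL Dt) = [set mple Dt S]) /\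
  argmax [set p : parameter R G D | is_nonneg p /\ has_imprecision S p]
    (piLL Dt) = [set mple Dt S].
Proof.
(* [mP] makes the estimate admissible for the range [0,1]; an entry can exceed 1 when [S i > 1]. *)
split=> [mP|]; apply: argmax_piLL => //.
- by move=> p [pP pS]; split=> // i j k; have /andP[] := pP i j k.
- by split=> //; exact: mple_imprecision.
- by split; [exact: mple_ge0|exact: mple_imprecision].
Qed.
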